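(* Let $\mathcal{E}:0\to I\to E\xrightarrow{\pi}H\to0$ be an extension of a left skew brace $H$ by a trivial left brace $I$ such that $[\mathcal{E}]\in\mathrm{Ext}_{(\nu,\mu,\sigma)}(H,I)$. Then there is an exact sequence $$0\to \mathrm{Z}^1_N(H,I)\to\mathrm{Autb}_I(E)\xrightarrow{\rho(\mathcal{E})}\mathrm{C}_{(\nu,\mu,\sigma)}\xrightarrow{\omega(\mathcal{E})}\mathrm{H}^2_N(H,I),$$ where the first two nontrivial maps are group homomorphisms and $\omega(\mathcal{E})$ is, in general, only a derivation, i.e. $\omega(\mathcal{E})(c_1c_2)=\omega(\mathcal{E})(c_1)^{c_2}+\omega(\mathcal{E})(c_2)$ for all $c_1,c_2\in \mathrm{C}_{(\nu,\mu,\sigma)}$; exactness at $\mathrm{C}_{(\nu,\mu,\sigma)}$ means $\mathrm{Im}(\rho(\mathcal{E}))=\{c:\omega(\mathcal{E})(c)=0\}$.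
   Context: A left skew brace is a set $E$ with operations $+,\circ$ such that $(E,+)$ and $(E,\circ)$ are groups (not necessarily abelian) and $a\circ(b+c)=a\circ b-a+a\circ c$ for all $a,b,c$. Both groups have the same identity $0$; $a^{-1}$ is the inverse in $(E,\circ)$. A brace homomorphism preserves both operations; $\mathrm{Autb}(E)$ is the group of bijective brace endomorphisms. A trivial brace $I$ is an abelian group $(I,+)$ with $\circ=+$; then $\mathrm{Autb}(I)=\mathrm{Aut}(I,+)$. Good triplet: $(\nu,\mu,\sigma)$ with $\nu:(H,\circ)\to \mathrm{Aut}(I,+)$ a homomorphism and $\mu:(H,+)\to\mathrm{Aut}(I,+)$, $\sigma:(H,\circ)\to\mathrm{Aut}(I,+)$ anti-homomorphisms such that for all $h_1,h_2,h_3\in H$, $y\in I$: $$\mu_{-h_1+(h_1\circ h_3)}(y)=-\nu_{h_1\circ(h_2+h_3)}(\sigma_{h_2+h_3}(\nu_{h_1}^{-1}(y)))+\mu_{-h_1+(h_1\circ h_3)}(\nu_{h_1\circ h_2}(\sigma_{h_2}(\nu_{h_1}^{-1}(y))))+\nu_{h_1\circ h_3}(\sigma_{h_3}(\nu_{h_1}^{-1}(y))),$$ $$\mu_{-h_1+(h_1\circ h_3)}(\nu_{h_1}(y))=\nu_{h_1}(\mu_{h_3}(y)).$$ Cohomology: $C^1_N$ is the group of functions $\theta:H\to I$ with $\theta(0)=0$. $C^2_N$ is the group of pairs $(g,f)$ of functions $H\times H\to I$ vanishing whenever one argument is $0$. $\partial^1(\theta)=(g,f)$, where $g(h_1,h_2)=\theta(h_2)-\theta(h_1+h_2)+\mu_{h_2}(\theta(h_1))$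 and $f(h_1,h_2)=\nu_{h_1}(\theta(h_2))-\theta(h_1\circ h_2)+\nu_{h_1\circ h_2}(\sigma_{h_2}(\nu_{h_1}^{-1}(\theta(h_1))))$. For $(g,f)\in C^2_N$, $\partial^2(g,f)=(\partial_v^{0,2}(g),\ \partial_h^{0,2}(g)-\partial_v^{1,1}(f),\ \partial_h^{1,1}(f))$, a triple of functions $H^3\to I$ with - $\partial_v^{0,2}(g)(h_1,h_2,h_3)=g(h_2,h_3)-g(h_1+h_2,h_3)+g(h_1,h_2+h_3)-\mu_{h_3}(g(h_1,h_2))$, - $\partial_h^{0,2}(g)(h_1,h_2,h_3)=\nu_{h_1}(g(h_2,h_3))+\mu_{h_1\circ h_3}(g(h_1,-h_1))-\mu_{h_1\circ h_3}(g(h_1\circ h_2,-h_1))-g((h_1\circ h_2)-h_1,h_1\circ h_3)$, - $\partial_v^{1,1}(f)(h_1,h_2,h_3)=\mu_{-h_1+(h_1\circ h_3)}(f(h_1,h_2))-f(h_1,h_2+h_3)+f(h_1,h_3)$, - $\partial_h^{1,1}(f)(h_1,h_2,h_3)=\nu_{h_1}(f(h_2,h_3))-f(h_1\circ h_2,h_3)+f(h_1,h_2\circ h_3)-\nu_{h_1\circ h_2\circ h_3}(\sigma_{h_3}(\nu_{h_1\circ h_2}^{-1}(f(h_1,h_2))))$. $\mathrm{Z}^1_N(H,I)=\mathrm{Ker}(\partial^1)$ (derivations), $\mathrm{Z}^2_N=\mathrm{Ker}(\partial^2)$, $\mathrm{B}^2_N=\mathrm{Im}(\partial^1)\subseteq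 \mathrm{Z}^2_N$, $\mathrm{H}^2_N(H,I)=\mathrm{Z}^2_N/\mathrm{B}^2_N$. Extensions: an extension of $H$ by $I$ is an exact sequence $0\to I\xrightarrow{i}E\xrightarrow{\pi}H\to0$ of brace homomorphisms of left skew braces ($i$ injective, $\pi$ surjective); $I$ is viewed as an ideal of $E$ via $i$. $E,E'$ are equivalent if there is a brace homomorphism $\phi:E\to E'$ with $\phi i=i'$, $\pi'\phi=\pi$; $[\mathcal E]$ is the equivalence class. An st-section is a map $s:H\to E$ with $\pi s=\mathrm{Id}$, $s(0)=0$. The triplet of an extension is $\nu_h(y)=-s(h)+(s(h)\circ y)$, $\mu_h(y)=-s(h)+y+s(h)$, $\sigma_h(y)=s(h)^{-1}\circ y\circ s(h)$; it is a good triplet depending only on $[\mathcal E]$. $\mathrm{Ext}_{(\nu,\mu,\sigma)}(H,I)$ is the set of classes of extensions with triplet $(\nu,\mu,\sigma)$. For $(\beta,\tau)\in \mathrm{Z}^2_N$, $(H,I,\nu,\mu,\sigma,\beta,\tau)$ denotes the extension with underlying set $H\times I$, $(h_1,y_1)+(h_2,y_2)=(h_1+h_2,\mu_{h_2}(y_1)+y_2+\beta(h_1,h_2))$, $(h_1,y_1)\circ(h_2,y_2)=(h_1\circ h_2,\nu_{h_1\circ h_2}(\sigma_{h_2}(\nu_{h_1}^{-1}(y_1)))+\nu_{h_1}(y_2)+\tau(h_1,h_2))$, $i(y)=(0,y)$, $\pi(h,y)=h$; the map $[(\beta,\tau)]\mapsto[(H,I,\nu,\mu,\sigma,\beta,\tau)]$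 is a bijection $\mathrm{H}^2_N(H,I)\to\mathrm{Ext}_{(\nu,\mu,\sigma)}(H,I)$. Actions and maps: $\mathrm{C}_{(\nu,\mu,\sigma)}=\{(\phi,\theta)\in\mathrm{Autb}(H)\times\mathrm{Autb}(I)\mid \nu_h=\theta^{-1}\nu_{\phi(h)}\theta,\ \mu_h=\theta^{-1}\mu_{\phi(h)}\theta,\ \sigma_h=\theta^{-1}\sigma_{\phi(h)}\theta\ \forall h\in H\}$. It acts on the right on $\mathrm{Ext}_{(\nu,\mu,\sigma)}(H,I)$ by $[\mathcal E]^{(\phi,\theta)}=[\,0\to I\xrightarrow{i\theta}E\xrightarrow{\phi^{-1}\pi}H\to0\,]$ and on $\mathrm{H}^2_N(H,I)$ by $[(\beta,\tau)]^{(\phi,\theta)}=[(\beta^{(\phi,\theta)},\tau^{(\phi,\theta)})]$, where $f^{(\phi,\theta)}(h_1,h_2)=\theta^{-1}(f(\phi(h_1),\phi(h_2)))$. $\mathrm{H}^2_N(H,I)$ acts simply transitively on $\mathrm{Ext}_{(\nu,\mu,\sigma)}(H,I)$ by $[(H,I,\nu,\mu,\sigma,\beta,\tau)]^{[(\beta_1,\tau_1)]}=[(H,I,\nu,\mu,\sigma,\beta+\beta_1,\tau+\tau_1)]$. The map $\omega(\mathcal E)$ sends $c$ to the unique $h_c\in\mathrm{H}^2_N(H,I)$ with $[\mathcal E]^c=[\mathcal E]^{h_c}$. $\mathrm{Autb}_I(E)=\{\gamma\in\mathrm{Autb}(E)\mid\gamma(I)=I\}$ and $\rho(\mathcal E)(\gamma)=(\gamma_H,\gamma_I)$,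 where $\gamma_I=\gamma|_I$ and $\gamma_H(h)=\pi(\gamma(s(h)))$ for any st-section $s$. *)

(* Defs.v *)
From HB Require Import structures.
From mathcomp Require Import all_boot ssralg generic_quotient ring_quotient.
From mathcomp Require Import boolp classical_sets functions.

Set Implicit Arguments.
Unset Strict Implicit.
Unset Printing Implicit Defensive.

Import GRing.Theory.
Local Open Scope classical_set_scope.
Local Open Scope ring_scope.

(* The additive group of a skew brace need not be abelian, so it cannot be a
   [zmodType]: it is built on the bare signature (0, +) of [nmodule], with its
   own opposite [sbopp] (written with a circled minus), while the circle group
   is the library's [groupType].  The two neutral elements coincide as a
   consequence of the axioms, see [sb_one0] below. *)
HB.mixin Record isSkewBrace E of Group E & Algebra.BaseAddUMagma E := {
  sbopp : E -> E;
  sbaddA : associative (@GRing.add E);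
  sbadd0x : left_id 0 (@GRing.add E);
  sbaddx0 : right_id 0 (@GRing.add E);
  sbaddNx : left_inverse 0 sbopp (@GRing.add E);
  sbaddxN : right_inverse 0 sbopp (@GRing.add E);
  sbdist : forall a b c : E,
    (a * (b + c)%R)%g = (a * b)%g + sbopp a + (a * c)%g
}.

#[short(type="skewBraceType")]
HB.structure Definition SkewBrace :=
  {E of isSkewBrace E & Group E & Algebra.BaseAddUMagma E}.

Notation "⊖ a" := (sbopp a) (at level 35, right associativity) : ring_scope.
Notation "a ⊖ b" := (a + sbopp b) (at level 50, left associativity) : ring_scope.

HB.mixin Record isTrivialBrace I of SkewBrace I & GRing.Zmodule I := {
  circ_add : forall a b : I, (a * b)%g = a + b
}.

#[short(type="trivialBraceType")]
HB.structure Definition TrivialBrace :=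
  {I of isTrivialBrace I & SkewBrace I & GRing.Zmodule I}.

Notation "a ∘ b" := (a * b)%g
  (at level 40, left associativity, only parsing) : ring_scope.

Section SkewBraceTheory.
Variable E : skewBraceType.
Implicit Types a b c : E.

Lemma sbaddK a b : a + b ⊖ b = a.
Proof. by rewrite -sbaddA sbaddxN sbaddx0. Qed.

Lemma sbaddNK a b : a ⊖ b + b = a.
Proof. by rewrite -sbaddA sbaddNx sbaddx0. Qed.

Lemma sbKadd a b : ⊖ a + (a + b) = b.
Proof. by rewrite sbaddA sbaddNx sbadd0x. Qed.

Lemma sbNKadd a b : a + (⊖ a + b) = b.
Proof. by rewrite sbaddA sbaddxN sbadd0x. Qed.

Lemma sbaddI a b c : a + b = a + c -> b = c.
Proof. by move=> /(congr1 (fun x => ⊖ a + x)); rewrite !sbKadd. Qed.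

Lemma sbaddIr a b c : b + a = c + a -> b = c.
Proof. by move=> /(congr1 (fun x => x ⊖ a)); rewrite !sbaddK. Qed.

Lemma sb_one0 : 1%g = 0 :> E.
Proof.
have := sbdist (1 : E)%g 1%g 1%g; rewrite !mul1g sbaddxN sbadd0x => e.
by apply: (@sbaddI 1%g); rewrite e sbaddx0.
Qed.

Lemma sbcirc0x a : 0 ∘ a = a.
Proof. by rewrite -sb_one0 mul1g. Qed.

Lemma sbcircx0 a : a ∘ 0 = a.
Proof. by rewrite -sb_one0 mulg1. Qed.

End SkewBraceTheory.

Definition brace_morphism (E F : skewBraceType) (f : E -> F) : Prop :=
  {morph f : x y / x + y} /\ {morph f : x y / x ∘ y}.

Section BraceMorphism.
Variables (E F : skewBraceType) (f : E -> F).
Hypothesis fM : brace_morphism f.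

Lemma bmorphD a b : f (a + b) = f a + f b. Proof. exact: fM.1. Qed.
Lemma bmorphM a b : f (a ∘ b) = f a ∘ f b. Proof. exact: fM.2. Qed.
Lemma bmorph0 : f 0 = 0.
Proof. by apply: (@sbaddI _ (f 0)); rewrite -bmorphD !sbaddx0. Qed.
Lemma bmorphN a : f (⊖ a) = ⊖ f a.
Proof. by apply: (@sbaddI _ (f a)); rewrite -bmorphD !sbaddxN bmorph0. Qed.
Lemma bmorphV a : f a^-1%g = (f a)^-1%g.
Proof.
by apply: (mulgI (f a)); rewrite -bmorphM !mulgV !sb_one0 bmorph0.
Qed.

End BraceMorphism.

Section Autb.
Variable E : skewBraceType.

(* Bijectivity is recorded through an explicit two-sided inverse, which is
   determined by the map (see [autbP]). *)
Record Autb := MkAutb {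
  autb_fun :> E -> E;
  autb_inv : E -> E;
  autb_morph : brace_morphism autb_fun;
  autb_funK : cancel autb_fun autb_inv;
  autb_invK : cancel autb_inv autb_fun
}.

HB.instance Definition _ := gen_eqMixin Autb.
HB.instance Definition _ := gen_choiceMixin Autb.

Lemma autbP (f g : Autb) : f =1 g -> f = g.
Proof.
case: f => f f' fM fK f'K; case: g => g g' gM gK g'K /= /funext efg.
subst g; have e : f' = g'.
  by apply/funext => x; rewrite -[x in LHS]g'K fK.
by subst g'; congr MkAutb; exact: Prop_irrelevance.
Qed.

Definition autb_one : Autb.
Proof. by exists id id. Defined.

Definition autb_mul (f g : Autb) : Autb.
Proof.
exists (f \o g) (autb_inv g \o autb_inv f).
- by split=> x y /=; rewrite ?(bmorphD (autb_morph _)) ?(bmorphM (autb_morph _)).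
- by move=> x /=; rewrite !autb_funK.
- by move=> x /=; rewrite !autb_invK.
Defined.

Definition autb_opp (f : Autb) : Autb.
Proof.
exists (autb_inv f) f.
- split=> x y; apply: (can_inj (autb_funK f)); rewrite autb_invK.
  + by rewrite (bmorphD (autb_morph _)) !autb_invK.
  + by rewrite (bmorphM (autb_morph _)) !autb_invK.
- exact: autb_invK.
- exact: autb_funK.
Defined.

Fact autb_mulA : associative autb_mul.
Proof. by move=> f g h; apply: autbP. Qed.
Fact autb_mul1x : left_id autb_one autb_mul.
Proof. by move=> f; apply: autbP. Qed.
Fact autb_mulx1 : right_id autb_one autb_mul.
Proof. by move=> f; apply: autbP. Qed.
Fact autb_mulVx : left_inverse autb_one autb_opp autb_mul.
Proof. by move=> f; apply: autbP => x /=; rewrite autb_funK. Qed.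
Fact autb_mulxV : right_inverse autb_one autb_opp autb_mul.
Proof. by move=> f; apply: autbP => x /=; rewrite autb_invK. Qed.

(* The product is composition of maps: (f * g) x = f (g x). *)
HB.instance Definition _ :=
  isGroup.Build Autb autb_mulA autb_mul1x autb_mulx1 autb_mulVx autb_mulxV.

Lemma autbM (f g : Autb) x : (f * g)%g x = f (g x). Proof. by []. Qed.
Lemma autb1 x : (1%g : Autb) x = x. Proof. by []. Qed.
Lemma autbV (f : Autb) x : autb_inv f x = (f^-1%g : Autb) x. Proof. by []. Qed.
Lemma autbK (f : Autb) x : (f^-1%g : Autb) (f x) = x.
Proof. exact: autb_funK. Qed.
Lemma autbVK (f : Autb) x : f ((f^-1%g : Autb) x) = x.
Proof. exact: autb_invK. Qed.
Lemma autbD (f : Autb) : {morph f : x y / x + y}.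
Proof. exact: (autb_morph f).1. Qed.
Lemma autbC (f : Autb) : {morph f : x y / x ∘ y}.
Proof. exact: (autb_morph f).2. Qed.
Lemma autb0 (f : Autb) : f 0 = 0.
Proof. exact: bmorph0 (autb_morph f). Qed.
Lemma autbN (f : Autb) x : f (⊖ x) = ⊖ f x.
Proof. exact: (bmorphN (autb_morph f)). Qed.

End Autb.

HB.instance Definition _ (I : trivialBraceType) (f : Autb I) :=
  GRing.isNmodMorphism.Build I I f (conj (autb0 f) (autbD f)).

Lemma autbNr (I : trivialBraceType) (f : Autb I) x : f (- x) = - f x.
Proof. exact: raddfN. Qed.

Record goodTriplet (H : skewBraceType) (I : trivialBraceType) := GoodTriplet {
  nu : H -> Autb I;
  mu : H -> Autb I;
  sigma : H -> Autb I;
  nuM : forall h1 h2, nu (h1 ∘ h2) = (nu h1 * nu h2)%g;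
  muD : forall h1 h2, mu (h1 + h2) = (mu h2 * mu h1)%g;
  sigmaM : forall h1 h2, sigma (h1 ∘ h2) = (sigma h2 * sigma h1)%g;
  good_mu : forall (h1 h2 h3 : H) (y : I),
    mu (⊖ h1 + (h1 ∘ h3)) y =
      - nu (h1 ∘ (h2 + h3)) (sigma (h2 + h3) ((nu h1)^-1%g y))
      + mu (⊖ h1 + (h1 ∘ h3)) (nu (h1 ∘ h2) (sigma h2 ((nu h1)^-1%g y)))
      + nu (h1 ∘ h3) (sigma h3 ((nu h1)^-1%g y));
  good_mu_nu : forall (h1 h3 : H) (y : I),
    mu (⊖ h1 + (h1 ∘ h3)) (nu h1 y) = nu h1 (mu h3 y)
}.

Section TripletTheory.
Variables (H : skewBraceType) (I : trivialBraceType) (T : goodTriplet H I).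

Lemma nu0 : nu T 0 = 1%g.
Proof. by apply: (mulgI (nu T 0)); rewrite -nuM mulg1 sbcircx0. Qed.
Lemma mu0 : mu T 0 = 1%g.
Proof. by apply: (mulgI (mu T 0)); rewrite -muD mulg1 sbaddx0. Qed.
Lemma sigma0 : sigma T 0 = 1%g.
Proof. by apply: (mulgI (sigma T 0)); rewrite -sigmaM mulg1 sbcircx0. Qed.

End TripletTheory.

Section Cochains.
Variables (H : skewBraceType) (I : trivialBraceType).

Definition is_C1 (th : H -> I) : bool := th 0 == 0.

Record C1 := MkC1 { c1_fun :> H -> I; c1P : is_C1 c1_fun }.

Fact is_C1_zmod : zmod_closed is_C1.
Proof.
split=> [|f g]; first by rewrite unfold_in /is_C1.
rewrite !unfold_in /is_C1 => /eqP f0 /eqP g0.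
by rewrite -[(f - g) 0]/(f 0 - g 0) f0 g0 subrr.
Qed.

HB.instance Definition _ := [isSub for c1_fun].
HB.instance Definition _ := [Choice of C1 by <:].
HB.instance Definition _ :=
  GRing.SubChoice_isSubZmodule.Build _ is_C1 C1 is_C1_zmod.

Definition is_C2 (gf : (H -> H -> I) * (H -> H -> I)) : bool :=
  `[< forall h, [/\ gf.1 h 0 = 0, gf.1 0 h = 0, gf.2 h 0 = 0 & gf.2 0 h = 0] >].

Record C2 := MkC2 { c2_pair : (H -> H -> I) * (H -> H -> I); c2P : is_C2 c2_pair }.

Fact is_C2_zmod : zmod_closed is_C2.
Proof.
split=> [|x y]; rewrite !unfold_in; first by apply/asboolP.
move=> /asboolP xP /asboolP yP; apply/asboolP => h.
have [x1 x2 x3 x4] := xP h; have [y1 y2 y3 y4] := yP h.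
rewrite -![(x - y).1 _ _]/(x.1 _ _ - y.1 _ _) -![(x - y).2 _ _]/(x.2 _ _ - y.2 _ _).
by rewrite x1 x2 x3 x4 y1 y2 y3 y4 subrr.
Qed.

HB.instance Definition _ := [isSub for c2_pair].
HB.instance Definition _ := [Choice of C2 by <:].
HB.instance Definition _ :=
  GRing.SubChoice_isSubZmodule.Build _ is_C2 C2 is_C2_zmod.

End Cochains.

Section Cohomology.
Variables (H : skewBraceType) (I : trivialBraceType) (T : goodTriplet H I).
Local Notation nu := (nu T).
Local Notation mu := (mu T).
Local Notation sigma := (sigma T).

Definition d1g (th : H -> I) (h1 h2 : H) : I :=
  th h2 - th (h1 + h2) + mu h2 (th h1).

Definition d1f (th : H -> I) (h1 h2 : H) : I :=
  nu h1 (th h2) - th (h1 ∘ h2)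
  + nu (h1 ∘ h2) (sigma h2 ((nu h1)^-1%g (th h1))).

Fact d1_is_C2 (th : C1 H I) : is_C2 (d1g th, d1f th).
Proof.
have th0 : th 0 = 0 by apply/eqP; exact: (c1P th).
apply/asboolP => h; rewrite /= /d1g /d1f.
rewrite !sbaddx0 !sbadd0x !sbcircx0 !sbcirc0x th0 mu0 nu0 sigma0.
by rewrite !autb0 ?autb1 autbVK !addr0 !sub0r addNr subrr.
Qed.

Definition d1 (th : C1 H I) : C2 H I := MkC2 (d1_is_C2 th).

Definition dv02 (g : H -> H -> I) (h1 h2 h3 : H) : I :=
  g h2 h3 - g (h1 + h2) h3 + g h1 (h2 + h3) - mu h3 (g h1 h2).

Definition dh02 (g : H -> H -> I) (h1 h2 h3 : H) : I :=
  nu h1 (g h2 h3) + mu (h1 ∘ h3) (g h1 (⊖ h1))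
  - mu (h1 ∘ h3) (g (h1 ∘ h2) (⊖ h1))
  - g ((h1 ∘ h2) ⊖ h1) (h1 ∘ h3).

Definition dv11 (f : H -> H -> I) (h1 h2 h3 : H) : I :=
  mu (⊖ h1 + (h1 ∘ h3)) (f h1 h2) - f h1 (h2 + h3) + f h1 h3.

Definition dh11 (f : H -> H -> I) (h1 h2 h3 : H) : I :=
  nu h1 (f h2 h3) - f (h1 ∘ h2) h3 + f h1 (h2 ∘ h3)
  - nu (h1 ∘ h2 ∘ h3) (sigma h3 ((nu (h1 ∘ h2))^-1%g (f h1 h2))).

Definition d2 (z : C2 H I) :
    (H -> H -> H -> I) * (H -> H -> H -> I) * (H -> H -> H -> I) :=
  let: (g, f) := c2_pair z in (dv02 g, dh02 g - dv11 f, dh11 f).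

Lemma fct1B (f g : H -> I) h : (f - g) h = f h - g h.
Proof. by []. Qed.

Lemma fct2B (f g : H -> H -> I) h1 h2 : (f - g) h1 h2 = f h1 h2 - g h1 h2.
Proof. by []. Qed.

Lemma fct2D (f g : H -> H -> I) h1 h2 : (f + g) h1 h2 = f h1 h2 + g h1 h2.
Proof. by []. Qed.

Fact d1B (th1 th2 : C1 H I) : d1 (th1 - th2) = d1 th1 - d1 th2.
Proof.
apply/val_inj => /=.
rewrite -[RHS]/(d1g th1 - d1g th2, d1f th1 - d1f th2).
congr (_, _); apply/funext => h1; apply/funext => h2.
- rewrite -[RHS]/(d1g th1 h1 h2 - d1g th2 h1 h2) /d1g.
  rewrite !fct1B !raddfB /= ?opprD ?opprK !addrA.
  by rewrite [LHS](ACl (1*3*5*2*4*6)).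
- rewrite -[RHS]/(d1f th1 h1 h2 - d1f th2 h1 h2) /d1f.
  rewrite !fct1B !raddfB /= ?opprD ?opprK !addrA.
  by rewrite [LHS](ACl (1*3*5*2*4*6)).
Qed.

Fact d2B (x y : C2 H I) : d2 (x - y) = d2 x - d2 y.
Proof.
case: x y => -[g f] ? [[g' f'] ?]; rewrite /d2 /=.
rewrite -[RHS]/(dv02 g - dv02 g', (dh02 g - dv11 f) - (dh02 g' - dv11 f'),
  dh11 f - dh11 f').
congr (_, _, _); apply/funext => h1; apply/funext => h2; apply/funext => h3.
- rewrite -[RHS]/(dv02 g h1 h2 h3 - dv02 g' h1 h2 h3) /dv02.
  rewrite !fct2B !raddfB /= ?opprD ?opprK !addrA.
  by rewrite [LHS](ACl (1*3*5*7*2*4*6*8)).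
- rewrite -[LHS]/(dh02 (g - g') h1 h2 h3 - dv11 (f - f') h1 h2 h3).
  rewrite -[RHS]/((dh02 g h1 h2 h3 - dv11 f h1 h2 h3)
                 - (dh02 g' h1 h2 h3 - dv11 f' h1 h2 h3)) /dh02 /dv11.
  rewrite !fct2B !raddfB /= ?opprD ?opprK !addrA.
  rewrite [LHS](ACl ((1*3*5*7*9*11*13)*((2*4*6*8)*(10*12*14)))) /=.
  by rewrite [RHS](ACl ((1*2*3*4*5*6*7)*((8*9*10*11)*(12*13*14)))).
- rewrite -[RHS]/(dh11 f h1 h2 h3 - dh11 f' h1 h2 h3) /dh11.
  rewrite !fct2B !raddfB /= ?opprD ?opprK !addrA.
  by rewrite [LHS](ACl (1*3*5*7*2*4*6*8)).
Qed.

Fact d1_0 : d1 0 = 0.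
Proof. by rewrite -(subrr 0) d1B subrr. Qed.

Fact d2_0 : d2 0 = 0.
Proof. by rewrite -(subrr 0) d2B subrr. Qed.

Definition is_Z1 (th : C1 H I) : bool := d1 th == 0.

Record Z1 := MkZ1 { z1_val :> C1 H I; z1P : is_Z1 z1_val }.

Fact is_Z1_zmod : zmod_closed is_Z1.
Proof.
split=> [|x y]; rewrite !unfold_in /is_Z1; first by rewrite d1_0.
by move=> /eqP dx /eqP dy; rewrite d1B dx dy subrr.
Qed.

HB.instance Definition _ := [isSub for z1_val].
HB.instance Definition _ := [Choice of Z1 by <:].
HB.instance Definition _ :=
  GRing.SubChoice_isSubZmodule.Build _ is_Z1 Z1 is_Z1_zmod.

Definition is_Z2 (z : C2 H I) : bool := d2 z == 0.

Record Z2 := MkZ2 { z2_val :> C2 H I; z2P : is_Z2 z2_val }.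

Fact is_Z2_zmod : zmod_closed is_Z2.
Proof.
split=> [|x y]; rewrite !unfold_in /is_Z2; first by rewrite d2_0.
by move=> /eqP dx /eqP dy; rewrite d2B dx dy subrr.
Qed.

HB.instance Definition _ := [isSub for z2_val].
HB.instance Definition _ := [Choice of Z2 by <:].
HB.instance Definition _ :=
  GRing.SubChoice_isSubZmodule.Build _ is_Z2 Z2 is_Z2_zmod.

(* The image of [d1], as a subset of the subgroup [Z2] by which it is to be
   factored out. *)
Definition B2 : {pred Z2} := fun z => `[< exists th : C1 H I, d1 th = z2_val z >].

Fact B2_zmod : zmod_closed B2.
Proof.
split=> [|x y]; rewrite !unfold_in; first by apply/asboolP; exists 0; exact: d1_0.
move=> /asboolP [tx dx] /asboolP [ty dy]; apply/asboolP.
by exists (tx - ty); rewrite d1B dx dy.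
Qed.

HB.instance Definition _ := GRing.isZmodClosed.Build Z2 B2 B2_zmod.

Definition H2 := Quotient.quot B2.
HB.instance Definition _ := GRing.Zmodule.on H2.

End Cohomology.

Section CocycleExtension.
Variables (H : skewBraceType) (I : trivialBraceType) (T : goodTriplet H I).
Local Notation nu := (nu T).
Local Notation mu := (mu T).
Local Notation sigma := (sigma T).

Definition beta (z : Z2 T) : H -> H -> I := (c2_pair z).1.
Definition tau (z : Z2 T) : H -> H -> I := (c2_pair z).2.

Lemma beta0 (z : Z2 T) h : beta z h 0 = 0 /\ beta z 0 h = 0.
Proof. by have /asboolP /(_ h) [] := c2P z. Qed.

Lemma tau0 (z : Z2 T) h : tau z h 0 = 0 /\ tau z 0 h = 0.
Proof. by have /asboolP /(_ h) [] := c2P z. Qed.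

Lemma Z2_eqs (z : Z2 T) h1 h2 h3 :
  [/\ dv02 T (beta z) h1 h2 h3 = 0,
      dh02 T (beta z) h1 h2 h3 = dv11 T (tau z) h1 h2 h3 &
      dh11 T (tau z) h1 h2 h3 = 0].
Proof.
have /eqP := z2P z; rewrite /d2 /beta /tau; case: (c2_pair z) => g f /=.
move=> dz; split.
- exact: (congr1 (fun x => x.1.1 h1 h2 h3) dz).
- by apply/eqP; rewrite -subr_eq0; apply/eqP;
    exact: (congr1 (fun x => x.1.2 h1 h2 h3) dz).
- exact: (congr1 (fun x => x.2 h1 h2 h3) dz).
Qed.

Variable z : Z2 T.

Lemma cocycle_add h1 h2 h3 :
  beta z h2 h3 + beta z h1 (h2 + h3) = mu h3 (beta z h1 h2) + beta z (h1 + h2) h3.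
Proof.
have [+ _ _] := Z2_eqs z h1 h2 h3; rewrite /dv02 => /eqP.
by rewrite subr_eq0 addrAC subr_eq => /eqP.
Qed.

Lemma cocycle_circ h1 h2 h3 :
  nu h1 (tau z h2 h3) + tau z h1 (h2 ∘ h3) =
  nu (h1 ∘ h2 ∘ h3) (sigma h3 ((nu (h1 ∘ h2))^-1%g (tau z h1 h2)))
  + tau z (h1 ∘ h2) h3.
Proof.
have [_ _ +] := Z2_eqs z h1 h2 h3; rewrite /dh11 => /eqP.
by rewrite subr_eq0 addrAC subr_eq => /eqP.
Qed.

Lemma cocycle_dist h1 h2 h3 :
  nu h1 (beta z h2 h3) + tau z h1 (h2 + h3) =
  mu (⊖ h1 + (h1 ∘ h3)) (tau z h1 h2)
  - mu (h1 ∘ h3) (beta z h1 (⊖ h1)) + mu (h1 ∘ h3) (beta z (h1 ∘ h2) (⊖ h1))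
  + tau z h1 h3 + beta z ((h1 ∘ h2) ⊖ h1) (h1 ∘ h3).
Proof.
have [_ + _] := Z2_eqs z h1 h2 h3; rewrite /dh02 /dv11 => /eqP.
rewrite subr_eq subr_eq => /eqP /(canRL (addrK _)) ->.
by rewrite [LHS](ACl (1*6*5*3*4*(2*7))) /= addNr addr0.
Qed.

(* An alias of the product type, indexed by the cocycle [z] so that it carries
   the twisted operations and not the componentwise ones. *)
Definition cocycle_brace : Type := let _ := z in (H * I)%type.
HB.instance Definition _ := Choice.on cocycle_brace.
Implicit Types a b c : cocycle_brace.

Definition coc_add a b : cocycle_brace :=
  (a.1 + b.1, mu b.1 a.2 + b.2 + beta z a.1 b.1).

Definition coc_opp a : cocycle_brace :=
  (⊖ a.1, - (mu (⊖ a.1) a.2 + beta z a.1 (⊖ a.1))).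

Definition coc_circ a b : cocycle_brace :=
  (a.1 ∘ b.1,
   nu (a.1 ∘ b.1) (sigma b.1 ((nu a.1)^-1%g a.2)) + nu a.1 b.2 + tau z a.1 b.1).

Definition coc_inv a : cocycle_brace :=
  ((a.1)^-1%g,
   (nu a.1)^-1%g (- (sigma (a.1)^-1%g ((nu a.1)^-1%g a.2) + tau z a.1 (a.1)^-1%g))).

Definition coc_zero : cocycle_brace := (0, 0).

Fact coc_addA : associative coc_add.
Proof.
move=> [h1 y1] [h2 y2] [h3 y3]; rewrite /coc_add /=; congr (_, _).
  exact: sbaddA.
rewrite muD autbM !autbD.
rewrite -[LHS]addrA -[X in _ + X]addrA.
have -> : mu h3 y2 + y3 + (beta z h2 h3 + beta z h1 (h2 + h3)) =
  mu h3 y2 + y3 + (mu h3 (beta z h1 h2) + beta z (h1 + h2) h3).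
  by rewrite cocycle_add.
by rewrite !addrA [LHS](ACl (1*2*4*3*5)).
Qed.

Fact coc_add0x : left_id coc_zero coc_add.
Proof.
by move=> [h y]; rewrite /coc_add /= sbadd0x autb0 add0r (beta0 z h).2 addr0.
Qed.

Fact coc_addx0 : right_id coc_zero coc_add.
Proof.
by move=> [h y]; rewrite /coc_add /= sbaddx0 mu0 (beta0 z h).1 !addr0.
Qed.

Fact coc_addxN : right_inverse coc_zero coc_opp coc_add.
Proof.
move=> [h y]; rewrite /coc_add /coc_opp /= sbaddxN; congr (_, _).
by rewrite addrAC subrr.
Qed.

Fact coc_circA : associative coc_circ.
Proof.
move=> [h1 y1] [h2 y2] [h3 y3]; rewrite /coc_circ /=; congr (_, _).
  exact: mulgA.
rewrite !autbV sigmaM autbM !autbD !mulgA.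
have e x : nu h1 (nu (h2 * h3)%g x) = nu (h1 * h2 * h3)%g x.
  by rewrite -autbM -nuM mulgA.
have e' x : (nu (h1 * h2)%g)^-1%g (nu h1 x) = (nu h2)^-1%g x.
  by rewrite nuM invgM autbM autbK.
have e'' x : nu h1 (nu h2 x) = nu (h1 * h2)%g x by rewrite nuM autbM.
rewrite e e' autbK e'' -[LHS]addrA -[X in _ + X]addrA cocycle_circ !addrA.
by rewrite [LHS](ACl (1*2*4*3*5)).
Qed.

Fact coc_circ1x : left_id coc_zero coc_circ.
Proof.
move=> [h y]; rewrite /coc_circ /= sbcirc0x autbV nu0 !autb0 add0r autb1.
by rewrite (tau0 z h).2 addr0.
Qed.

Fact coc_circx1 : right_id coc_zero coc_circ.
Proof.
move=> [h y]; rewrite /coc_circ /= !autbV sbcircx0 autb0 sigma0 autb1 autbVK.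
by rewrite (tau0 z h).1 !addr0.
Qed.

Fact coc_circxV : right_inverse coc_zero coc_inv coc_circ.
Proof.
move=> [h y]; rewrite /coc_circ /coc_inv /= mulgV sb_one0; congr (_, _).
by rewrite nu0 autb1 !autbV autbVK addrAC subrr.
Qed.

Fact right_inv_left (G : Type) (op : G -> G -> G) (e : G) (i : G -> G) :
  associative op -> left_id e op -> right_id e op -> right_inverse e i op ->
  left_inverse e i op.
Proof.
move=> A e1 e2 V x; rewrite -[LHS]e2 -[X in op _ X](V (i x)) A.
by rewrite -(A (i x)) V e2 V.
Qed.

HB.instance Definition _ := isGroup.Build cocycle_brace
  coc_circA coc_circ1x coc_circx1
  (right_inv_left coc_circA coc_circ1x coc_circx1 coc_circxV) coc_circxV.

HB.instance Definition _ := Algebra.hasAdd.Build cocycle_brace coc_add.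
HB.instance Definition _ := Algebra.hasZero.Build cocycle_brace coc_zero.

Fact coc_dist a b c :
  coc_circ a (coc_add b c) =
  coc_add (coc_add (coc_circ a b) (coc_opp a)) (coc_circ a c).
Proof.
move: a b c => [h1 y1] [h2 y2] [h3 y3].
rewrite /coc_circ /coc_add /coc_opp /=; congr (_, _); first exact: sbdist.
have e x : mu (h1 * h3)%g (mu (⊖ h1) x) = mu (⊖ h1 + h1 ∘ h3) x.
  by rewrite muD autbM.
have := good_mu T h1 h2 h3 y1; rewrite [RHS](ACl (2*3*1)) /=.
move=> /eqP; rewrite eq_sym subr_eq addrC -subr_eq => /eqP/esym eS.
rewrite !autbV !autbD !autbNr !autbD !opprD !e good_mu_nu eS !autbV.
rewrite -[LHS]addrA -[X in _ + X = _]addrA cocycle_dist !opprD !opprK !addrA.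
rewrite [RHS](ACl ((1*5)*(4*9)*6*2*10*3*7*8*11*12)) /=.
by rewrite subrr addNr !add0r.
Qed.

HB.instance Definition _ := isSkewBrace.Build cocycle_brace
  coc_addA coc_add0x coc_addx0
  (right_inv_left coc_addA coc_add0x coc_addx0 coc_addxN) coc_addxN coc_dist.

End CocycleExtension.

Record extension (H : skewBraceType) (I : trivialBraceType) := Extension {
  ext_brace :> skewBraceType;
  ext_i : I -> ext_brace;
  ext_pi : ext_brace -> H;
  ext_i_morph : brace_morphism ext_i;
  ext_pi_morph : brace_morphism ext_pi;
  ext_i_inj : injective ext_i;
  ext_pi_surj : forall h, exists e, ext_pi e = h;
  ext_exact : forall e, ext_pi e = 0 <-> exists y, ext_i y = e
}.

Section Extensions.
Variables (H : skewBraceType) (I : trivialBraceType).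
Implicit Types E F : extension H I.

Definition ext_equiv E F : Prop :=
  exists phi : E -> F, [/\ brace_morphism phi,
    forall y, phi (ext_i E y) = ext_i F y &
    forall e, ext_pi (phi e) = ext_pi e].

(* Classes live as predicates because [set] is confined to a smaller
   universe than that of [extension]. *)
Definition ext_class E : extension H I -> Prop := fun F => ext_equiv E F.

Definition st_section E (s : H -> E) : Prop :=
  (forall h, ext_pi (s h) = h) /\ s 0 = 0.

Variable T : goodTriplet H I.

(* The formulas do not depend on the chosen st-section. *)
Definition has_triplet E : Prop :=
  forall s : H -> E, st_section s -> forall (h : H) (y : I),
    [/\ ext_i E (nu T h y) = ⊖ s h + (s h ∘ ext_i E y),
        ext_i E (mu T h y) = ⊖ s h + ext_i E y + s h &
        ext_i E (sigma T h y) = (s h)^-1%g ∘ ext_i E y ∘ s h].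

Definition Ext : (extension H I -> Prop) -> Prop :=
  fun X => exists2 E, has_triplet E & X = ext_class E.

Definition coc_i (z : Z2 T) (y : I) : cocycle_brace z := (0, y).
Definition coc_pi (z : Z2 T) (e : cocycle_brace z) : H := e.1.

Fact coc_i_morph z : brace_morphism (@coc_i z).
Proof.
split=> y y'; apply/esym; rewrite /coc_i.
  rewrite -[LHS]/(coc_add (z := z) (0, y) (0, y')) /coc_add /=.
  by rewrite sbadd0x mu0 (beta0 z 0).1 addr0.
rewrite -[LHS]/(coc_circ (z := z) (0, y) (0, y')) /coc_circ /= !autbV.
by rewrite sbcirc0x nu0 sigma0 !autb1 (tau0 z 0).1 addr0 -[y in LHS](autbVK 1%g) circ_add.
Qed.

Fact coc_pi_morph z : brace_morphism (@coc_pi z).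
Proof. by []. Qed.

Fact coc_i_inj z : injective (@coc_i z).
Proof. by move=> y y' []. Qed.

Fact coc_pi_surj z h : exists e : cocycle_brace z, coc_pi e = h.
Proof. by exists (h, 0). Qed.

Fact coc_exact z (e : cocycle_brace z) :
  coc_pi e = 0 <-> exists y, coc_i z y = e.
Proof.
case: e => h y; split=> [/= -> | [y' [<-]]]; last by [].
by exists y.
Qed.

Definition cocycle_ext (z : Z2 T) : extension H I :=
  Extension (coc_i_morph z) (coc_pi_morph z) (@coc_i_inj z) (@coc_pi_surj z)
    (@coc_exact z).

End Extensions.

(* Products of automorphisms are compositions of maps (see [Autb]), so the
   compatibility of (phi, theta) reads nu_h = theta^-1 nu_(phi h) theta. *)
Section CompatiblePairs.
Variables (H : skewBraceType) (I : trivialBraceType) (T : goodTriplet H I).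

Definition is_compatible : {pred Autb H * Autb I} := fun c =>
  `[< forall h, [/\ nu T h = (c.2^-1 * nu T (c.1 h) * c.2)%g,
                    mu T h = (c.2^-1 * mu T (c.1 h) * c.2)%g &
                    sigma T h = (c.2^-1 * sigma T (c.1 h) * c.2)%g] >].

Record Cgroup := MkC { c_pair : Autb H * Autb I; cP : is_compatible c_pair }.

Fact is_compatible_group : group_closed is_compatible.
Proof.
have conj_div (G : groupType) (x y w b b' : G) :
    (w = b'^-1 * x * b' -> w = b^-1 * y * b -> x = (b / b')^-1 * y * (b / b'))%g.
  move=> -> /(congr1 (fun u => b' * u / b')%g); rewrite !mulgA mulgV mul1g mulgK.
  by move=> ->; rewrite invgF.
split=> [|[a b] [a' b']]; rewrite !unfold_in.
  by apply/asboolP => h /=; rewrite !invg1 !mul1g !mulg1.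
move=> /asboolP ab /asboolP ab'; apply/asboolP => h /=.
have [n m s] := ab ((a' ^-1)%g h); have [] := ab' ((a'^-1)%g h).
rewrite /= autbVK => n' m' s'.
by split; [apply: conj_div n' n | apply: conj_div m' m | apply: conj_div s' s].
Qed.

HB.instance Definition _ := [isSub for c_pair].
HB.instance Definition _ := [Choice of Cgroup by <:].
HB.instance Definition _ :=
  SubChoice_isSubGroup.Build _ is_compatible Cgroup is_compatible_group.

End CompatiblePairs.

Section CompatibleTheory.
Variables (H : skewBraceType) (I : trivialBraceType) (T : goodTriplet H I).
Variable c : Cgroup T.
Local Notation phi := (c_pair c).1.
Local Notation theta := (c_pair c).2.

Lemma compat_nu h y :
  (theta^-1)%g (nu T (phi h) y) = nu T h ((theta^-1)%g y).
Proof.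
by have /asboolP /(_ h) [-> _ _] := cP c; rewrite !autbM autbVK.
Qed.

Lemma compat_mu h y :
  (theta^-1)%g (mu T (phi h) y) = mu T h ((theta^-1)%g y).
Proof.
by have /asboolP /(_ h) [_ -> _] := cP c; rewrite !autbM autbVK.
Qed.

Lemma compat_sigma h y :
  (theta^-1)%g (sigma T (phi h) y) = sigma T h ((theta^-1)%g y).
Proof.
by have /asboolP /(_ h) [_ _ ->] := cP c; rewrite !autbM autbVK.
Qed.

Lemma compat_nuV h y :
  (theta^-1)%g ((nu T (phi h))^-1%g y) = (nu T h)^-1%g ((theta^-1)%g y).
Proof. by rewrite -[LHS](autbK (nu T h)) -compat_nu autbVK. Qed.

End CompatibleTheory.

Section Actions.
Variables (H : skewBraceType) (I : trivialBraceType) (T : goodTriplet H I).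
Implicit Types (E F : extension H I) (c : Cgroup T).

Section OnExtensions.
Variables (E : extension H I) (c : Cgroup T).
Local Notation phi := (c_pair c).1.
Local Notation theta := (c_pair c).2.

Let act_i (y : I) : E := ext_i E (theta y).
Let act_pi (e : E) : H := (phi^-1)%g (ext_pi e).

Fact act_i_morph : brace_morphism act_i.
Proof.
by split=> x y; rewrite /act_i ?autbD ?autbC ?(bmorphD (ext_i_morph E))
  ?(bmorphM (ext_i_morph E)).
Qed.

Fact act_pi_morph : brace_morphism act_pi.
Proof.
by split=> x y; rewrite /act_pi ?(bmorphD (ext_pi_morph E))
  ?(bmorphM (ext_pi_morph E)) ?autbD ?autbC.
Qed.

Fact act_i_inj : injective act_i.
Proof. by move=> x y /ext_i_inj /(can_inj (autbK theta)). Qed.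

Fact act_pi_surj h : exists e, act_pi e = h.
Proof.
by have [e pe] := ext_pi_surj E (phi h); exists e; rewrite /act_pi pe autbK.
Qed.

Fact act_exact e : act_pi e = 0 <-> exists y, act_i y = e.
Proof.
rewrite /act_pi /act_i; split=> [/(congr1 phi)|[y <-]].
  rewrite autbVK autb0 => /ext_exact [y <-].
  by exists ((theta^-1)%g y); rewrite autbVK.
by rewrite (ext_exact _).2 ?autb0 //; exists (theta y).
Qed.

Definition ext_act : extension H I :=
  Extension act_i_morph act_pi_morph act_i_inj act_pi_surj act_exact.

End OnExtensions.

(* Both actions on [Ext T] are given on equivalence classes, seen as
   predicates on extensions. *)
Definition Ext_actC (X : extension H I -> Prop) c : extension H I -> Prop :=
  fun F => exists2 E, X E & ext_equiv (ext_act E c) F.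

Definition H2_class (z : Z2 T) : H2 T := (\pi_(H2 T) z)%qT.

Definition Ext_actH2 (X : extension H I -> Prop) (k : H2 T) :
    extension H I -> Prop :=
  fun F => exists z z1 : Z2 T, [/\ X (cocycle_ext z), H2_class z1 = k &
    ext_equiv (cocycle_ext (z + z1)) F].

Definition fun_act c (f : H -> H -> I) (h1 h2 : H) : I :=
  ((c_pair c).2^-1)%g (f ((c_pair c).1 h1) ((c_pair c).1 h2)).

Fact fun_act_is_C2 c (z : C2 H I) :
  is_C2 (fun_act c (c2_pair z).1, fun_act c (c2_pair z).2).
Proof.
apply/asboolP => h; have /asboolP /(_ ((c_pair c).1 h)) [e1 e2 e3 e4] := c2P z.
by rewrite /= /fun_act (autb0 (c_pair c).1) e1 e2 e3 e4 autb0.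
Qed.

Definition C2_act (z : C2 H I) c : C2 H I := MkC2 (fun_act_is_C2 c z).

Fact Z2_act_is_Z2 (z : Z2 T) c : is_Z2 T (C2_act z c).
Proof.
rewrite /is_Z2; apply/eqP; rewrite /d2 /=.
have D := @autbD I ((c_pair c).2^-1)%g; have N := @autbNr I ((c_pair c).2^-1)%g.
have D' := @autbD H (c_pair c).1; have C' := @autbC H (c_pair c).1.
have N' := @autbN H (c_pair c).1.
have eqs h1 h2 h3 :=
  Z2_eqs z ((c_pair c).1 h1) ((c_pair c).1 h2) ((c_pair c).1 h3).
congr (_, _, _); apply/funext => h1; apply/funext => h2; apply/funext => h3.
- have [/(congr1 ((c_pair c).2^-1)%g) + _ _] := eqs h1 h2 h3.
  by rewrite autb0 /dv02 /fun_act !D !N compat_mu -!D'.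
- have [_ /(congr1 ((c_pair c).2^-1)%g) + _] := eqs h1 h2 h3.
  move=> e; rewrite -[LHS]/(dh02 T _ h1 h2 h3 - dv11 T _ h1 h2 h3).
  apply/eqP; rewrite subr_eq0; apply/eqP; move: e.
  rewrite /dh02 /dv11 /fun_act !D !N -!N' -!C' -!D'.
  by rewrite !compat_mu compat_nu.
- have [_ _ /(congr1 ((c_pair c).2^-1)%g)] := eqs h1 h2 h3.
  rewrite autb0 /dh11 /fun_act !D !N -!C'.
  by rewrite !compat_nu compat_sigma compat_nuV.
Qed.

Definition Z2_act (z : Z2 T) c : Z2 T := MkZ2 (Z2_act_is_Z2 z c).

(* Defined on a representative; [H2_actE] shows that the choice is immaterial. *)
Definition H2_act (k : H2 T) c : H2 T := H2_class (Z2_act (repr k) c).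

Fact fun_act_is_C1 c (th : C1 H I) :
  is_C1 (fun h => ((c_pair c).2^-1)%g (th ((c_pair c).1 h))).
Proof. by rewrite /is_C1 autb0 (eqP (c1P th)) autb0. Qed.

Lemma H2_actE (z : Z2 T) c : H2_act (H2_class z) c = H2_class (Z2_act z c).
Proof.
rewrite /H2_act; set z' := repr _.
have : z' - z \in @B2 H I T.
  by rewrite Quotient.idealrBE; apply/eqP; rewrite /z' reprK.
rewrite unfold_in => /asboolP [th dth].
apply/eqP; rewrite -Quotient.idealrBE unfold_in; apply/asboolP.
exists (MkC1 (fun_act_is_C1 c th)); apply/val_inj.
have D := @autbD I ((c_pair c).2^-1)%g; have N := @autbNr I ((c_pair c).2^-1)%g.
have D' := @autbD H (c_pair c).1; have C' := @autbC H (c_pair c).1.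
have dg h1 h2 : d1g T th h1 h2 = beta z' h1 h2 - beta z h1 h2.
  by have /(congr1 (fun x : C2 H I => (c2_pair x).1 h1 h2)) := dth.
have df h1 h2 : d1f T th h1 h2 = tau z' h1 h2 - tau z h1 h2.
  by have /(congr1 (fun x : C2 H I => (c2_pair x).2 h1 h2)) := dth.
rewrite -[RHS]/(fun_act c (beta z') - fun_act c (beta z),
                fun_act c (tau z') - fun_act c (tau z)).
congr (_, _); apply/funext => h1; apply/funext => h2.
- rewrite fct2B /fun_act -N -D -dg /d1g !D !N -D'.
  by rewrite compat_mu.
- rewrite fct2B /fun_act -N -D -df /d1f !D !N -C'.
  by rewrite !compat_nu compat_sigma compat_nuV.
Qed.

End Actions.

Section Wells.
Variables (H : skewBraceType) (I : trivialBraceType) (T : goodTriplet H I).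
Variable E : extension H I.

Definition is_stable : {pred Autb E} :=
  fun g => `[< [set g e | e in range (ext_i E)] = range (ext_i E) >].

Record AutbI := MkAutbI { autbI_val :> Autb E; autbIP : is_stable autbI_val }.

Lemma is_stableP (g : Autb E) :
  reflect (forall e, ext_pi (g e) = 0 <-> ext_pi e = 0) (is_stable g).
Proof.
  rewrite /is_stable; apply: (iffP (asboolP _)) => [gI e|gI].
    split=> [/ext_exact [y ey]|/ext_exact [y ey]]; apply/ext_exact.
      have : range (ext_i E) (g e) by exists y.
      rewrite -gI => -[_ [y' _ <-]] /(can_inj (autbK g)) <-; by exists y'.
    have : [set g e | e in range (ext_i E)] (g e).
      by exists e => //; exists y.
    by rewrite gI => -[y' _ <-]; exists y'.
  apply/seteqP; split=> e.
    move=> [e' [y _ ey] <-]; have : ext_pi (g e') = 0.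
      by apply/gI/ext_exact; exists y.
    by move=> /ext_exact [y' <-]; exists y'.
  move=> [y _ ey]; exists ((g^-1)%g e); rewrite ?autbVK //.
  have : ext_pi ((g^-1)%g e) = 0.
    by apply/gI; rewrite autbVK; apply/ext_exact; exists y.
  by move=> /ext_exact [y' <-]; exists y'.
Qed.

Fact is_stable_group : group_closed is_stable.
Proof.
split=> [|g g']; first exact/is_stableP.
rewrite !unfold_in => /is_stableP gI /is_stableP gI'; apply/is_stableP => e.
rewrite autbM; split=> [/gI|pe].
  by rewrite -gI' autbVK.
by apply/gI/gI'; rewrite autbVK.
Qed.

HB.instance Definition _ := [isSub for autbI_val].
HB.instance Definition _ := [Choice of AutbI by <:].
HB.instance Definition _ :=
  SubChoice_isSubGroup.Build _ is_stable AutbI is_stable_group.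

Lemma autbI_pi (g : AutbI) e : ext_pi (g e) = 0 <-> ext_pi e = 0.
Proof. exact: (elimT (is_stableP g) (autbIP g) e). Qed.

Lemma autbIV (g : AutbI) : autbI_val g^-1%g = (autbI_val g)^-1%g.
Proof. by []. Qed.

Definition ext_iinv (e : E) : I := xget 0 [set y | ext_i E y = e].

Lemma ext_iinvK e : ext_pi e = 0 -> ext_i E (ext_iinv e) = e.
Proof. by move=> /ext_exact; apply: xgetPex. Qed.

Lemma ext_pi_i y : ext_pi (ext_i E y) = 0.
Proof. by apply/ext_exact; exists y. Qed.

Definition the_section (h : H) : E :=
  if h == 0 then 0 else sval (cid (ext_pi_surj E h)).

Lemma the_section_st : st_section the_section.
Proof.
split=> [h|]; rewrite /the_section ?eqxx //.
by case: eqP => [->|_]; [exact: bmorph0 (ext_pi_morph E) | case: cid].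
Qed.

Definition gamma_I (g : AutbI) (y : I) : I := ext_iinv (g (ext_i E y)).

Definition gamma_H (g : AutbI) (h : H) : H := ext_pi (g (the_section h)).

Lemma gamma_IE g y : ext_i E (gamma_I g y) = g (ext_i E y).
Proof. by rewrite ext_iinvK //; apply/autbI_pi/ext_pi_i. Qed.

Lemma gamma_HE g e : gamma_H g (ext_pi e) = ext_pi (g e).
Proof.
have piM := ext_pi_morph E; rewrite /gamma_H.
set s := the_section _; have es : ext_pi s = ext_pi e := the_section_st.1 _.
have : ext_pi (g (⊖ s + e)) = 0.
  by apply/autbI_pi; rewrite (bmorphD piM) (bmorphN piM) es sbaddNx.
rewrite autbD autbN (bmorphD piM) (bmorphN piM).
by move=> /(congr1 (fun h => ext_pi (g s) + h)); rewrite sbNKadd sbaddx0.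
Qed.

Fact gamma_I_morph g : brace_morphism (gamma_I g).
Proof.
have iM := ext_i_morph E.
split=> x y; apply: (@ext_i_inj _ _ E).
  by rewrite (bmorphD iM) !gamma_IE (bmorphD iM) autbD.
by rewrite (bmorphM iM) !gamma_IE (bmorphM iM) autbC.
Qed.

Fact gamma_IK g : cancel (gamma_I g) (gamma_I g^-1%g).
Proof.
by move=> y; apply: (@ext_i_inj _ _ E); rewrite !gamma_IE autbIV autbK.
Qed.

Fact gamma_IVK g : cancel (gamma_I g^-1%g) (gamma_I g).
Proof.
by move=> y; apply: (@ext_i_inj _ _ E); rewrite !gamma_IE autbIV autbVK.
Qed.

Fact gamma_H_morph g : brace_morphism (gamma_H g).
Proof.
have piM := ext_pi_morph E.
split=> x y; have [e <-] := ext_pi_surj E x; have [e' <-] := ext_pi_surj E y.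
  by rewrite -(bmorphD piM) !gamma_HE autbD (bmorphD piM).
by rewrite -(bmorphM piM) !gamma_HE autbC (bmorphM piM).
Qed.

Fact gamma_HK g : cancel (gamma_H g) (gamma_H g^-1%g).
Proof.
by move=> h; have [e <-] := ext_pi_surj E h; rewrite !gamma_HE autbIV autbK.
Qed.

Fact gamma_HVK g : cancel (gamma_H g^-1%g) (gamma_H g).
Proof.
by move=> h; have [e <-] := ext_pi_surj E h; rewrite !gamma_HE autbIV autbVK.
Qed.

Definition rho_pair (g : AutbI) : Autb H * Autb I :=
  (MkAutb (gamma_H_morph g) (@gamma_HK g) (@gamma_HVK g),
   MkAutb (gamma_I_morph g) (@gamma_IK g) (@gamma_IVK g)).

Fact Ext_has_triplet : Ext T (ext_class E) -> has_triplet T E.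
Proof.
move=> [E0 tE0 eE]; have : ext_class E E0.
  by rewrite eE; exists id; split.
move=> [f [fM fi fpi]].
have f_inj : injective f.
  move=> a b fab.
  have pab : ext_pi (⊖ a + b) = 0.
    by rewrite -fpi (bmorphD fM) (bmorphN fM) fab sbaddNx (bmorph0 (ext_pi_morph E0)).
  have /ext_exact [y ey] := pab.
  have : ext_i E0 y = 0 by rewrite -fi ey (bmorphD fM) (bmorphN fM) fab sbaddNx.
  rewrite -(bmorph0 (ext_i_morph E0)) => /ext_i_inj y0.
  have : ⊖ a + b = 0 by rewrite -ey y0 (bmorph0 (ext_i_morph E)).
  by move=> /(congr1 (fun u => a + u)); rewrite sbNKadd sbaddx0.
move=> s [ps s0] h y.
have st0 : st_section (f \o s).
  by split=> [k|] /=; rewrite ?fpi ?ps // s0 (bmorph0 fM).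
have [en em es] := tE0 _ st0 h y.
split; apply: f_inj; rewrite fi ?en ?em ?es /= -fi.
- by rewrite (bmorphD fM) (bmorphN fM) (bmorphM fM).
- by rewrite !(bmorphD fM) (bmorphN fM).
- by rewrite !(bmorphM fM) (bmorphV fM).
Qed.

Fact rho_compatible (hE : Ext T (ext_class E)) g :
  is_compatible T (rho_pair g).
Proof.
have tE := Ext_has_triplet hE; have [ps s0] := the_section_st.
pose s' := g \o the_section \o gamma_H g^-1%g.
have st' : st_section s'.
  rewrite /s'; split=> [h|] /=.
    by rewrite -gamma_HE ps gamma_HVK.
  by rewrite (bmorph0 (gamma_H_morph _)) s0 autb0.
have s'E h : s' (gamma_H g h) = g (the_section h) by rewrite /s' /= gamma_HK.
apply/asboolP => h; set th := (rho_pair g).2; set ph := (rho_pair g).1.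
have conj (a b : Autb I) :
    (forall y, ext_i E (th (a y)) = ext_i E (b (th y))) ->
  a = (th^-1 * b * th)%g.
  move=> ab; apply: autbP => y; apply: (can_inj (autbK th)).
  by apply: (@ext_i_inj _ _ E); rewrite ab !autbM autbVK.
split; apply: conj => y.
all: have [en em es] := tE _ the_section_st h y.
all: have [en' em' es'] := tE _ st' (ph h) (th y).
all: rewrite ?en' ?em' ?es' [LHS]gamma_IE ?en ?em ?es s'E gamma_IE.
- by rewrite autbD autbN autbC.
- by rewrite !autbD autbN.
- by rewrite !autbC (bmorphV (autb_morph _)).
Qed.

Definition rho (hE : Ext T (ext_class E)) (g : AutbI) : Cgroup T :=
  MkC (rho_compatible hE g).

(* [the_section] may be replaced by any st-section. *)
Lemma rho_HE (hE : Ext T (ext_class E)) g (s : H -> E) h :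
  st_section s -> (c_pair (rho hE g)).1 h = ext_pi (g (s h)).
Proof. by move=> [ps _]; rewrite -gamma_HE ps. Qed.

(* The unique class [k] such that [E]^c = [E]^k; the value 0 would only be
   taken if no such [k] existed. *)
Definition omega (c : Cgroup T) : H2 T :=
  xget 0 [set k : H2 T | Ext_actC (ext_class E) c = Ext_actH2 (ext_class E) k].

End Wells.

(* Main.v *)
(* An automorphism of E that is trivial on I and on H moves every e by an element
   of I depending only on pi e, say e |-> e + th (pi e); this map is a brace
   morphism exactly when th is a derivation.  A choice of st-section identifies E
   with a cocycle extension of some z, and c carries that extension to the one of
   z^c, so that omega c = [z^c] - [z]: a derivation of principal shape, whose
   vanishing means that E and E^c are equivalent.  Such an equivalence, read as a
   self-map of E, is an automorphism inducing c. *)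
Require Import Defs.
From mathcomp Require Import all_boot ssralg generic_quotient ring_quotient.
From mathcomp Require Import boolp classical_sets functions.
Import GRing.Theory.
Local Open Scope ring_scope.

Set Implicit Arguments.
Unset Strict Implicit.
Unset Printing Implicit Defensive.

(** * Morphisms of extensions and the equivalence relation on them *)

Section ExtensionMaps.
Variables (H : skewBraceType) (I : trivialBraceType).
Implicit Types E F G : extension H I.

Lemma ext_iD E (x y : I) : ext_i E (x + y) = ext_i E x + ext_i E y.
Proof. exact: bmorphD (ext_i_morph E) _ _. Qed.

Lemma ext_iM E (x y : I) : ext_i E (x + y) = ext_i E x ∘ ext_i E y.
Proof. by rewrite -circ_add (bmorphM (ext_i_morph E)). Qed.

Lemma ext_i0 E : ext_i E 0 = 0.
Proof. exact: bmorph0 (ext_i_morph E). Qed.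

Lemma ext_piD E (e e' : E) : ext_pi (e + e') = ext_pi e + ext_pi e'.
Proof. exact: bmorphD (ext_pi_morph E) _ _. Qed.

Lemma ext_piM E (e e' : E) : ext_pi (e ∘ e') = ext_pi e ∘ ext_pi e'.
Proof. exact: bmorphM (ext_pi_morph E) _ _. Qed.

Lemma ext_piDi E (e : E) y : ext_pi (e + ext_i E y) = ext_pi e.
Proof. by rewrite ext_piD ext_pi_i sbaddx0. Qed.

Lemma ext_pi_eq E (e e' : E) :
  ext_pi e = ext_pi e' -> exists y, e' = e + ext_i E y.
Proof.
move=> pe; have : ext_pi (⊖ e + e') = 0.
  by rewrite ext_piD (bmorphN (ext_pi_morph E)) pe sbaddNx.
by move=> /ext_exact [y ey]; exists y; rewrite ey sbNKadd.
Qed.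

Lemma ext_add_inj E (e : E) x y : e + ext_i E x = e + ext_i E y -> x = y.
Proof. by move=> /sbaddI /ext_i_inj. Qed.

(** A short five lemma with automorphisms at both ends: identities there serve equivalences, a
    compatible pair serves the lifting of that pair to an automorphism of [E]. *)
Lemma ext_morph_bij E F (f : E -> F) (phi : Autb H) (theta : Autb I) :
  brace_morphism f -> (forall y, f (ext_i E y) = ext_i F (theta y)) ->
  (forall e, ext_pi (f e) = phi (ext_pi e)) ->
  exists2 g : F -> E, cancel f g & cancel g f.
Proof.
move=> fM fi fpi.
have f_inj a b : f a = f b -> a = b.
  move=> fab; have [|y eb] := @ext_pi_eq _ a b.
    by apply: (can_inj (autbK phi)); rewrite -!fpi fab.
  move: fab; rewrite eb (bmorphD fM) fi -{1}[f a]sbaddx0 -ext_i0.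
  move=> /ext_add_inj; rewrite -(autb0 theta) => /(can_inj (autbK theta)) <-.
  by rewrite ext_i0 sbaddx0.
have f_surj b : exists a, f a = b.
  (* For [a] over [phi^-1 (pi b)], the elements [f a] and [b] lie in one fibre, so they differ by
     some [y], which [theta^-1 y] corrects. *)
  have [a pa] := ext_pi_surj E ((phi^-1)%g (ext_pi b)).
  have [|y eb] := @ext_pi_eq _ (f a) b; first by rewrite fpi pa autbVK.
  by exists (a + ext_i E ((theta^-1)%g y)); rewrite (bmorphD fM) fi autbVK.
pose g b := sval (cid (f_surj b)); have fg b : f (g b) = b by rewrite /g; case: cid.
by exists g => // a; apply: f_inj; rewrite fg.
Qed.

Lemma ext_equiv_refl E : ext_equiv E E.
Proof. by exists id. Qed.

Lemma ext_equiv_trans E F G : ext_equiv E F -> ext_equiv F G -> ext_equiv E G.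
Proof.
move=> [f [fM fi fpi]] [g [gM gi gpi]]; exists (g \o f); split=> /=.
- by split=> x y /=; rewrite ?(bmorphD fM, bmorphD gM, bmorphM fM, bmorphM gM).
- by move=> y; rewrite fi gi.
- by move=> e; rewrite gpi fpi.
Qed.

Lemma cancel_morph (E F : skewBraceType) (f : E -> F) (g : F -> E) :
  brace_morphism f -> cancel f g -> cancel g f -> brace_morphism g.
Proof.
move=> fM fK gK; split=> x y; apply: (can_inj fK);
  by rewrite ?(bmorphD fM, bmorphM fM) !gK.
Qed.

(** An equivalence is only required to be a morphism; the five lemma with identities at both ends
    supplies its inverse. *)
Lemma ext_equiv_sym E F : ext_equiv E F -> ext_equiv F E.
Proof.
move=> [f [fM fi fpi]].
have [g fK gK] := @ext_morph_bij _ _ f 1%g 1%g fM fi fpi.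
exists g; split=> [|y|e]; first exact: cancel_morph fM fK gK.
  by apply: (can_inj fK); rewrite gK fi.
by rewrite -fpi gK.
Qed.

Lemma ext_class_eq E F : ext_class E = ext_class F <-> ext_equiv E F.
Proof.
split=> [eEF|EF].
  by apply: ext_equiv_sym; rewrite -[ext_equiv F E]/(ext_class F E) -eEF;
    exact: ext_equiv_refl.
apply/funext => G; apply/propext; split; last exact: ext_equiv_trans.
exact: ext_equiv_trans (ext_equiv_sym EF).
Qed.

End ExtensionMaps.

(** * The operations of an extension expressed through its triplet *)

Section TripletFormulas.
Variables (H : skewBraceType) (I : trivialBraceType) (T : goodTriplet H I).
Variables (E : extension H I) (tE : has_triplet T E).
Implicit Types e : E.

Let s := @the_section H I E.

Fact section_split e : exists y, e = s (ext_pi e) + ext_i E y.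
Proof. by apply: ext_pi_eq; rewrite (the_section_st E).1. Qed.

Let nu_s h y : s h ∘ ext_i E y = s h + ext_i E (nu T h y).
Proof. by have [-> _ _] := tE (the_section_st E) h y; rewrite sbNKadd. Qed.

Let add_s h y : s h + ext_i E y = s h ∘ ext_i E (((nu T h)^-1)%g y).
Proof. by rewrite nu_s autbVK. Qed.

(** The triplet is given on section values. Here and in the next two lemmas it passes to any lift,
    because two lifts differ by an element of [I], on which both operations are one commutative
    addition. *)
Lemma triplet_nu e y : e ∘ ext_i E y = e + ext_i E (nu T (ext_pi e) y).
Proof.
have [y' ->] := section_split e; rewrite ext_piDi (the_section_st E).1 add_s.
by rewrite -mulgA -ext_iM !nu_s autbD ext_iD sbaddA.
Qed.

Lemma triplet_mu e y : ext_i E y + e = e + ext_i E (mu T (ext_pi e) y).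
Proof.
have [y' ->] := section_split e; rewrite ext_piDi (the_section_st E).1.
have [_ em _] := tE (the_section_st E) (ext_pi e) y.
rewrite -[RHS]sbaddA -ext_iD [_ + mu _ _ _]addrC ext_iD em.
by rewrite !sbaddA sbaddxN sbadd0x.
Qed.

Lemma triplet_sigma e y : ext_i E y ∘ e = e ∘ ext_i E (sigma T (ext_pi e) y).
Proof.
have [y' ->] := section_split e; rewrite ext_piDi (the_section_st E).1 add_s.
have [_ _ es] := tE (the_section_st E) (ext_pi e) y.
by rewrite -[RHS]mulgA -ext_iM addrC ext_iM es !mulgA mulgV mul1g.
Qed.

Lemma ext_add e1 e2 y1 y2 :
  (e1 + ext_i E y1) + (e2 + ext_i E y2) =
  e1 + e2 + ext_i E (mu T (ext_pi e2) y1 + y2).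
Proof. by rewrite -!sbaddA [X in e1 + X]sbaddA triplet_mu -sbaddA -ext_iD. Qed.

(** Sums are first turned into circle products by [nu^-1]; then [y1] crosses [e2] through [sigma],
    and the result is turned back into a sum by [nu]. *)
Lemma ext_circ e1 e2 y1 y2 :
  (e1 + ext_i E y1) ∘ (e2 + ext_i E y2) =
  e1 ∘ e2 + ext_i E (nu T (ext_pi e1 ∘ ext_pi e2)
     (sigma T (ext_pi e2) (((nu T (ext_pi e1))^-1)%g y1)) + nu T (ext_pi e1) y2).
Proof.
have add_circ e y : e + ext_i E y = e ∘ ext_i E (((nu T (ext_pi e))^-1)%g y).
  by rewrite triplet_nu autbVK.
rewrite [X in X ∘ _]add_circ [X in _ ∘ X = _]add_circ mulgA.
rewrite -[in LHS](mulgA e1) triplet_sigma -2!mulgA -ext_iM mulgA triplet_nu.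
by rewrite ext_piM autbD nuM !autbM autbVK.
Qed.

End TripletFormulas.

(** * Translations along [I] and derivations *)

Section Translations.
Variables (H : skewBraceType) (I : trivialBraceType) (T : goodTriplet H I).
Variable E : extension H I.

Definition translate (th : H -> I) (e : E) : E := e + ext_i E (th (ext_pi e)).

Lemma translateD th1 th2 e :
  translate (fun h => th1 h + th2 h) e = translate th1 (translate th2 e).
Proof. by rewrite /translate ext_piDi addrC ext_iD sbaddA. Qed.

Lemma translate0 e : translate (fun=> 0) e = e.
Proof. by rewrite /translate ext_i0 sbaddx0. Qed.

Lemma translateNK th : cancel (translate th) (translate (fun h => - th h)).
Proof.
move=> e; rewrite -translateD -[RHS]translate0.
by congr translate; apply/funext => h; rewrite addNr.
Qed.

Lemma translateKN th : cancel (translate (fun h => - th h)) (translate th).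
Proof.
move=> e; rewrite -translateD -[RHS]translate0.
by congr translate; apply/funext => h; rewrite subrr.
Qed.

(** Puts the derivation equations in the subtraction-free form in which [ext_add] and [ext_circ]
    produce them. *)
Lemma d1_eq0 (th : C1 H I) :
  d1 T th = 0 <-> forall h1 h2,
    th (h1 + h2) = mu T h2 (th h1) + th h2 /\
    th (h1 ∘ h2) = nu T (h1 ∘ h2) (sigma T h2 ((nu T h1)^-1%g (th h1)))
                   + nu T h1 (th h2).
Proof.
have split0 (a b c : I) : a - b + c = 0 <-> b = c + a.
  rewrite addrAC [c + a]addrC; split=> [/eqP|->]; last exact: subrr.
  by rewrite subr_eq0 => /eqP.
split=> [d0 h1 h2|dE].
  split; apply/split0.
    exact: (congr1 (fun z : C2 H I => (c2_pair z).1 h1 h2) d0).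
  exact: (congr1 (fun z : C2 H I => (c2_pair z).2 h1 h2) d0).
apply/val_inj; congr (_, _); apply/funext => h1; apply/funext => h2;
  apply/split0; by have [] := dE h1 h2.
Qed.

(** Both sides of each morphism law share the same base element of [E], so the law reduces to an
    equality of the added elements of [I]; surjectivity of [ext_pi] reaches all [h1], [h2]. *)
Lemma translate_morph (th : C1 H I) : has_triplet T E ->
  brace_morphism (translate th) <-> d1 T th = 0.
Proof.
move=> tE; rewrite d1_eq0; split=> [tM h1 h2|dE].
  have [e1 <-] := ext_pi_surj E h1; have [e2 <-] := ext_pi_surj E h2.
  split.
    by have := tM.1 e1 e2; rewrite /translate (ext_add tE) ext_piD => /ext_add_inj.
  by have := tM.2 e1 e2; rewrite /translate (ext_circ tE) ext_piM => /ext_add_inj.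
split=> e1 e2; rewrite /translate ?(ext_add tE) ?(ext_circ tE).
  by rewrite ext_piD (dE _ _).1.
by rewrite ext_piM (dE _ _).2.
Qed.

End Translations.

(** * Multiplicativity and kernel of [rho] *)

Section Rho.
Variables (H : skewBraceType) (I : trivialBraceType) (T : goodTriplet H I).
Variables (E : extension H I) (hE : Ext T (ext_class E)).

(** Eliminates the section and the chosen preimages from [rho], so that its product, kernel and
    image can be studied by two equations on [E]. *)
Lemma rhoP g (c : Cgroup T) :
  rho hE g = c <->
  (forall y, g (ext_i E y) = ext_i E ((c_pair c).2 y)) /\
  (forall e : E, ext_pi (g e) = (c_pair c).1 (ext_pi e)).
Proof.
split=> [<-|[gi gpi]].
  by split=> [y|e]; [rewrite -gamma_IE | rewrite -gamma_HE].
apply/val_inj; rewrite [RHS]surjective_pairing; congr (_, _); apply: autbP.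
  by move=> h; have [e <-] := ext_pi_surj E h; rewrite -gpi; exact: gamma_HE.
by move=> y; apply: (@ext_i_inj _ _ E); rewrite -gi; exact: gamma_IE.
Qed.

Lemma rhoM : {morph rho hE : g1 g2 / (g1 * g2)%g >-> (g1 * g2)%g}.
Proof.
move=> g1 g2; apply/rhoP.
have [i1 p1] := (rhoP g1 _).1 erefl; have [i2 p2] := (rhoP g2 _).1 erefl.
split=> [y|e].
  by rewrite -[LHS]/(g1 (g2 _)) i2 i1.
by rewrite -[LHS]/(ext_pi (g1 (g2 e))) p1 p2.
Qed.

Let tE : has_triplet T E := Ext_has_triplet hE.

Fact derivation_morph (th : Z1 T) : brace_morphism (@translate H I E th).
Proof. by apply/(translate_morph _ tE)/eqP/(z1P th). Qed.

Definition derivation_autb (th : Z1 T) : Autb E :=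
  MkAutb (derivation_morph th) (@translateNK _ _ _ th) (@translateKN _ _ _ th).

Fact derivation_stable (th : Z1 T) : is_stable (derivation_autb th).
Proof. by apply/is_stableP => e; rewrite ext_piDi. Qed.

Definition derivation_autbI (th : Z1 T) : AutbI E :=
  MkAutbI (derivation_stable th).

Lemma derivation_autbI_inj : injective derivation_autbI.
Proof.
move=> th1 th2 eth; do 2!apply/val_inj; apply/funext => h.
have [e <-] := ext_pi_surj E h; apply: (@ext_add_inj _ _ E e).
exact: (congr1 (fun g : AutbI E => g e) eth).
Qed.

Lemma derivation_autbID :
  {morph derivation_autbI : th1 th2 / th1 + th2 >-> (th1 * th2)%g}.
Proof.
by move=> th1 th2; apply/val_inj/autbP => e; exact: translateD.
Qed.

Lemma ker_rho g :
  (exists th : Z1 T, derivation_autbI th = g) <-> rho hE g = 1%g.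
Proof.
split=> [[th <-]|/rhoP [gi gpi]].
  apply/rhoP; split=> [y|e] /=.
    by rewrite /translate ext_pi_i (eqP (c1P th)) ext_i0 sbaddx0.
  by rewrite ext_piDi.
pose s := @the_section H I E.
have shift h : exists y, g (s h) = s h + ext_i E y.
  by apply: ext_pi_eq; rewrite gpi.
pose th h := sval (cid (shift h)).
have thE h : g (s h) = s h + ext_i E (th h) by rewrite /th; case: cid.
(* The shift seen on section values is the same on the whole fibre, since [g] fixes [I] pointwise
   and [I] is commutative. *)
have gE : (g : E -> E) = translate th.
  apply/funext => e; have [y ey] := section_split e; rewrite {1}ey.
  rewrite autbD gi thE /translate -/s {3}ey -!sbaddA -!ext_iD.
  by congr (_ + ext_i E _); exact: addrC.
(* Normalisation comes from [s 0 = 0] and [g 0 = 0]. *)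
have th0 : is_C1 th.
  apply/eqP/(@ext_add_inj _ _ E 0); rewrite ext_i0 sbaddx0.
  by have := thE 0; rewrite /s (the_section_st E).2 autb0.
have dth : is_Z1 T (MkC1 th0).
  by apply/eqP/(translate_morph _ tE); rewrite -gE; exact: autb_morph.
exists (MkZ1 dth); apply/val_inj/autbP => e /=.
by rewrite gE.
Qed.

End Rho.

(** * Cocycle models of extensions and their equivalence *)

Section Classification.
Variables (H : skewBraceType) (I : trivialBraceType) (T : goodTriplet H I).
Implicit Types (E : extension H I) (z : Z2 T).

Lemma H2_class_eq z z' :
  H2_class z = H2_class z' <-> exists th : C1 H I, d1 T th = z2_val z - z2_val z'.
Proof.
by split=> [/eqP|dz]; [|apply/eqP]; rewrite -Quotient.idealrBE unfold_in;
  [move=> /asboolP|apply/asboolP].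
Qed.

Lemma H2_classB z z' : H2_class (z - z') = H2_class z - H2_class z'.
Proof. by rewrite /H2_class raddfB. Qed.

Lemma H2_classD z z' : H2_class (z + z') = H2_class z + H2_class z'.
Proof. by rewrite /H2_class raddfD. Qed.

Lemma H2_class_surj (k : H2 T) : exists z, H2_class z = k.
Proof. by exists (repr k); rewrite /H2_class reprK. Qed.

Lemma coc_addE z (a b : cocycle_ext z) :
  a + b = (a.1 + b.1, mu T b.1 a.2 + b.2 + beta z a.1 b.1) :> cocycle_brace z.
Proof. by []. Qed.

Lemma coc_circE z (a b : cocycle_ext z) :
  a ∘ b = (a.1 ∘ b.1, nu T (a.1 ∘ b.1) (sigma T b.1 (((nu T a.1)^-1)%g a.2))
            + nu T a.1 b.2 + tau z a.1 b.1) :> cocycle_brace z.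
Proof. by []. Qed.

Lemma coc_pair_split z h y :
  ((h, y) : cocycle_ext z) = ((h, 0) : cocycle_ext z) + ext_i (cocycle_ext z) y.
Proof.
by rewrite coc_addE /= sbaddx0 mu0 autb1 (beta0 z h).1 add0r addr0.
Qed.

(* [n - a + m] has the shape of [d1g] and [d1f], [x - c + y - m] that of [dv02]
   and [dh11]; the subtraction-free side is what comparing second components in
   a cocycle extension produces. *)
Lemma coboundary_eq (V : zmodType) (a b b' m n : V) :
  n - a + m = b - b' <-> a + b = m + n + b'.
Proof.
split=> e.
  have -> : b = n - a + m + b' by rewrite e subrK.
  by rewrite !addrA [LHS](ACl ((1*3)*4*2*5)) /= subrr add0r.
have -> : b = m + n + b' - a by rewrite -e [a + b]addrC addrK.
by rewrite [RHS](ACl (2*4*1*(3*5))) /= subrr addr0.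
Qed.

(** Extends a coboundary relation from the elements [(h, 0)] to arbitrary pairs: [u] and [v] are the
    contributions of the two [I]-coordinates. *)
Lemma add_shift (V : zmodType) (a b b' m n u v : V) :
  a + b = m + n + b' -> a + (u + v + b) = m + u + (n + v) + b'.
Proof.
by move=> e; rewrite addrCA e !addrA [RHS](ACl (2*4*1*3*5)).
Qed.

Lemma cocycle_eq (V : zmodType) (c m x y : V) :
  x + y = m + c -> x - c + y - m = 0.
Proof. by move=> e; rewrite [x - c + y]addrAC e addrK subrr. Qed.

(** The middle component of [d2]: [a + b - c - d] has the shape of [dh02] and [f - g + k] that of
    [dv11]. *)
Lemma distributive_cocycle_eq (V : zmodType) (a b c d f g k : V) :
  a + g = f - b + c + k + d -> a + b - c - d - (f - g + k) = 0.
Proof.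
move=> /(canRL (addrK _)) ->; rewrite !opprD opprK !addrA.
rewrite [LHS](ACl ((1*10)*(2*7)*(3*8)*(4*12)*(5*9)*(6*11))) /=.
by rewrite !addNr !subrr !addr0.
Qed.

(** An equivalence must have the form [(h, y) |-> (h, th h + y)], and its compatibility with each
    operation is one component of [d1 th = z - z']. Conversely, such a [th] defines the map. *)
Lemma coc_equiv z z' :
  ext_equiv (cocycle_ext z) (cocycle_ext z') <-> H2_class z = H2_class z'.
Proof.
rewrite H2_class_eq; split=> [[f [fM fi fpi]]|[th dth]].
  pose th h := (f (h, 0)).2.
  have fE h y : f (h, y) = (h, th h + y) :> cocycle_brace z'.
    rewrite coc_pair_split (bmorphD fM) fi.
    have -> : f (h, 0) = (h, th h) :> cocycle_brace z'.
      rewrite [LHS]surjective_pairing; congr (_, _); exact: (fpi (h, 0)).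
    by rewrite coc_addE /= sbaddx0 mu0 autb1 (beta0 z' h).1 addr0.
  have th0 : is_C1 th.
    by apply/eqP; exact: (congr1 snd (bmorph0 fM)).
  have dg h1 h2 : d1g T th h1 h2 = beta z h1 h2 - beta z' h1 h2.
    have := bmorphD fM (h1, 0) (h2, 0).
    rewrite !coc_addE !fE /= autb0 !add0r !addr0.
    by case=> /coboundary_eq.
  have df h1 h2 : d1f T th h1 h2 = tau z h1 h2 - tau z' h1 h2.
    have := bmorphM fM (h1, 0) (h2, 0).
    rewrite !coc_circE !fE /= !autbV !autb0 !add0r !addr0.
    by case=> /coboundary_eq.
  exists (MkC1 th0); apply/val_inj; congr (_, _);
    apply/funext => h1; apply/funext => h2; [exact: dg | exact: df].
have dg h1 h2 : d1g T th h1 h2 = beta z h1 h2 - beta z' h1 h2.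
  by have /(congr1 (fun x : C2 H I => (c2_pair x).1 h1 h2)) := dth.
have df h1 h2 : d1f T th h1 h2 = tau z h1 h2 - tau z' h1 h2.
  by have /(congr1 (fun x : C2 H I => (c2_pair x).2 h1 h2)) := dth.
exists (fun a => (a.1, th a.1 + a.2)); split.
- split=> -[h1 y1] [h2 y2].
    have /coboundary_eq e := dg h1 h2; rewrite !coc_addE /=; congr (_, _).
    by rewrite autbD; exact: add_shift.
  have /coboundary_eq e := df h1 h2; rewrite !coc_circE /=; congr (_, _).
  by rewrite !autbV !autbD; exact: add_shift.
- by move=> y; rewrite /= (eqP (c1P th)) add0r.
- by [].
Qed.

(** The cocycle measures the failure of a section to preserve the two operations. *)
Lemma ext_equiv_cocycle E :
  has_triplet T E -> exists z, ext_equiv (cocycle_ext z) E.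
Proof.
move=> tE; pose s := @the_section H I E.
have ps h : ext_pi (s h) = h := (the_section_st E).1 h.
have s0 : s 0 = 0 := (the_section_st E).2.
have [b bE] : exists b : H -> H -> I, forall h1 h2,
    s h1 + s h2 = s (h1 + h2) + ext_i E (b h1 h2).
  have D h1 h2 : exists y, s h1 + s h2 = s (h1 + h2) + ext_i E y.
    by apply: ext_pi_eq; rewrite ext_piD !ps.
  by exists (fun h1 h2 => sval (cid (D h1 h2))) => h1 h2; case: cid.
have [t tauE] : exists t : H -> H -> I, forall h1 h2,
    s h1 ∘ s h2 = s (h1 ∘ h2) + ext_i E (t h1 h2).
  have M h1 h2 : exists y, s h1 ∘ s h2 = s (h1 ∘ h2) + ext_i E y.
    by apply: ext_pi_eq; rewrite ext_piM !ps.
  by exists (fun h1 h2 => sval (cid (M h1 h2))) => h1 h2; case: cid.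
have C2bt : is_C2 (b, t).
  apply/asboolP => h; split; apply: (@ext_i_inj _ _ E); rewrite ext_i0 /=.
  - by apply: (@sbaddI _ (s h)); rewrite -{1}[h]sbaddx0 -bE s0.
  - by apply: (@sbaddI _ (s h)); rewrite -{1}[h]sbadd0x -bE s0 sbadd0x sbaddx0.
  - by apply: (@sbaddI _ (s h)); rewrite -{1}[h]sbcircx0 -tauE s0 sbcircx0 sbaddx0.
  - by apply: (@sbaddI _ (s h)); rewrite -{1}[h]sbcirc0x -tauE s0 sbcirc0x sbaddx0.
(* Coordinates on [E]; [p] is kept opaque so that [pD] and [pM] do all the computing. *)
have [p pE] : exists p : H -> I -> E, forall h y, p h y = s h + ext_i E y.
  by exists (fun h y => s h + ext_i E y).
have p_inj h h' y y' : h = h' -> p h y = p h' y' -> y = y'.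
  by move=> ->; rewrite !pE => /ext_add_inj.
have pD h1 h2 y1 y2 : p h1 y1 + p h2 y2 = p (h1 + h2) (mu T h2 y1 + y2 + b h1 h2).
  by rewrite !pE (ext_add tE) ps bE -sbaddA -ext_iD addrC.
have pM h1 h2 y1 y2 : p h1 y1 ∘ p h2 y2 = p (h1 ∘ h2)
    (nu T (h1 ∘ h2) (sigma T h2 ((nu T h1)^-1%g y1)) + nu T h1 y2 + t h1 h2).
  by rewrite !pE (ext_circ tE) !ps tauE -sbaddA -ext_iD addrC.
(* Needed for the opposite in the brace distributivity law; the second coordinate cancels the [b]
   term of the sum. *)
have pN h : ⊖ p h 0 = p (⊖ h) (- b h (⊖ h)).
  apply: (@sbaddI _ (p h 0)); rewrite sbaddxN pD autb0 add0r addNr sbaddxN pE s0.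
  by rewrite ext_i0 sbaddx0.
(* On the elements [p h 0], the three components are associativity of [+], distributivity, and
   associativity of the circle operation. *)
have Z2bt : is_Z2 T (MkC2 C2bt).
  apply/eqP; rewrite /d2 /=; congr (_, _, _);
    apply/funext => h1; apply/funext => h2; apply/funext => h3.
  - have := sbaddA (p h1 0) (p h2 0) (p h3 0); rewrite !pD.
    move=> /(p_inj _ _ _ _ (sbaddA _ _ _)); rewrite !autb0 !add0r !addr0.
    exact: cocycle_eq.
  - have := sbdist (p h1 0) (p h2 0) (p h3 0); rewrite pN !(pD, pM).
    move=> /(p_inj _ _ _ _ (sbdist _ _ _)).
    (* The successive actions of [mu (⊖ h1)] and [mu (h1 ∘ h3)] merge into the index occurring in
       [dv11]. *)
    rewrite !autb0 !add0r !autbD autbNr -autbM -muD.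
    move=> e; rewrite -[LHS]/(dh02 T b h1 h2 h3 - dv11 T t h1 h2 h3) /dh02 /dv11.
    exact: distributive_cocycle_eq.
  - have := mulgA (p h1 0) (p h2 0) (p h3 0); rewrite !pM.
    move=> /(p_inj _ _ _ _ (mulgA _ _ _)); rewrite !autb0 !add0r !addr0.
    exact: cocycle_eq.
exists (MkZ2 Z2bt), (fun a => s a.1 + ext_i E a.2); split.
- by split=> -[h1 y1] [h2 y2]; rewrite -!pE ?pD ?pM.
- by move=> y; rewrite /= s0 sbadd0x.
- by move=> [h y]; rewrite ext_piDi ps.
Qed.

End Classification.

(** * The actions on classes, the map [omega] and the image of [rho] *)

Section ClassActions.
Variables (H : skewBraceType) (I : trivialBraceType) (T : goodTriplet H I).
Implicit Types (E F : extension H I) (z : Z2 T) (c : Cgroup T).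

Lemma ext_act_equiv E F c :
  ext_equiv E F -> ext_equiv (ext_act E c) (ext_act F c).
Proof.
by move=> [f [fM fi fpi]]; exists f; split=> [|y|e] //=; rewrite ?fi ?fpi.
Qed.

(** The inverses appear because the new inclusion is [i theta] and the new projection [phi^-1 pi];
    relabelling both coordinates turns [z] into [z^c]. *)
Lemma ext_act_cocycle z c :
  ext_equiv (ext_act (cocycle_ext z) c) (cocycle_ext (Z2_act z c)).
Proof.
exists (fun a : cocycle_ext z =>
  (((c_pair c).1^-1)%g a.1, ((c_pair c).2^-1)%g a.2)).
have be h1 h2 : ((c_pair c).2^-1)%g (beta z h1 h2) =
    beta (Z2_act z c) (((c_pair c).1^-1)%g h1) (((c_pair c).1^-1)%g h2).
  by rewrite -[RHS]/(fun_act c (beta z) _ _) /fun_act !autbVK.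
have ta h1 h2 : ((c_pair c).2^-1)%g (tau z h1 h2) =
    tau (Z2_act z c) (((c_pair c).1^-1)%g h1) (((c_pair c).1^-1)%g h2).
  by rewrite -[RHS]/(fun_act c (tau z) _ _) /fun_act !autbVK.
split=> [|y|e] //; last by rewrite /= /coc_i !autbV autbK autb0.
set ph := (_.1^-1)%g in be ta *; set th := (_.2^-1)%g in be ta *.
(* Indices must be displayed as values of [phi] before the compatibility lemmas apply. *)
have phK h : (c_pair c).1 (ph h) = h by exact: autbVK.
split=> a b; rewrite ?coc_addE ?coc_circE; congr (_, _); rewrite ?autbD ?autbC //.
  by rewrite be -{1}[b.1]phK compat_mu.
rewrite ta -{1 2 3}[a.1]phK -{1 2}[b.1]phK -autbC.
by rewrite !compat_nu compat_sigma compat_nuV.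
Qed.

Lemma Ext_actCE E z c : ext_equiv (cocycle_ext z) E ->
  Ext_actC (ext_class E) c = ext_class (cocycle_ext (Z2_act z c)).
Proof.
move=> zE; apply/funext => F; apply/propext; split=> [[E' EE' E'F]|zF].
  apply: ext_equiv_trans E'F.
  apply: ext_equiv_trans (ext_equiv_sym (ext_act_cocycle z c)) _.
  exact: ext_act_equiv (ext_equiv_trans zE EE').
exists (cocycle_ext z); first exact: ext_equiv_sym.
exact: ext_equiv_trans (ext_act_cocycle z c) zF.
Qed.

(** The representatives in the action are immaterial, since equivalence only sees the class of
    [z + z1]. *)
Lemma Ext_actH2E E z z1 : ext_equiv (cocycle_ext z) E ->
  Ext_actH2 (ext_class E) (H2_class z1) = ext_class (cocycle_ext (z + z1)).
Proof.
move=> zE; apply/funext => F; apply/propext.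
split=> [[z' [z1' [Ez' ez1 zF]]]|zF].
  apply: ext_equiv_trans zF; apply/coc_equiv; rewrite !H2_classD ez1.
  by congr (_ + _); apply/coc_equiv; exact: ext_equiv_trans zE Ez'.
by exists z, z1; split=> //; exact: ext_equiv_sym.
Qed.

(** In cohomology the condition reads [[z^c] = [z] + k], which has exactly one solution. *)
Lemma Ext_act_eq E z c k : ext_equiv (cocycle_ext z) E ->
  Ext_actC (ext_class E) c = Ext_actH2 (ext_class E) k <->
  k = H2_class (Z2_act z c) - H2_class z.
Proof.
move=> zE; have [z1 <-] := H2_class_surj k.
rewrite (Ext_actCE _ zE) (Ext_actH2E _ zE) ext_class_eq coc_equiv H2_classD.
by split=> [->|->]; rewrite ?[_ + H2_class z1]addrC ?addrK // addrC subrK.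
Qed.

Lemma omegaE E z c : ext_equiv (cocycle_ext z) E ->
  omega E c = H2_class (Z2_act z c) - H2_class z.
Proof.
move=> zE; rewrite /omega; case: xgetP => [k _ /(Ext_act_eq _ _ zE) //|].
(* The default value of [xget] is excluded, as [[z^c] - [z]] is a solution. *)
by move=> /(_ _ ((Ext_act_eq _ _ zE).2 erefl)).
Qed.

Lemma H2_actB (k k' : H2 T) c : H2_act (k - k') c = H2_act k c - H2_act k' c.
Proof.
have [z <-] := H2_class_surj k; have [z' <-] := H2_class_surj k'.
rewrite -H2_classB !H2_actE -H2_classB; congr H2_class; do 2!apply/val_inj.
have fB f f' : fun_act c (f - f') = fun_act c f - fun_act c f'.
  by apply/funext => h1; apply/funext => h2; rewrite /fun_act fct2B autbD autbNr.
by rewrite -[LHS]/(fun_act c (beta z - beta z'), fun_act c (tau z - tau z')) !fB.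
Qed.

(** Both sides are convertible: inverting [theta1 theta2] reverses the order, whence a right
    action. *)
Lemma Z2_actM z c1 c2 : Z2_act z (c1 * c2)%g = Z2_act (Z2_act z c1) c2.
Proof. by do 2!apply/val_inj. Qed.

(** Acting by [c2] on [[z^c1] - [z]] and adding [[z^c2] - [z]] telescopes to [[z^(c1 c2)] - [z]]. *)
Lemma omega_derivation E c1 c2 : (exists z, ext_equiv (cocycle_ext z) E) ->
  omega E (c1 * c2)%g = H2_act (omega E c1) c2 + omega E c2.
Proof.
move=> [z zE]; rewrite !(omegaE _ zE) Z2_actM H2_actB !H2_actE.
by rewrite addrA subrK.
Qed.

Lemma omega_eq0 E c : (exists z, ext_equiv (cocycle_ext z) E) ->
  omega E c = 0 <-> ext_equiv E (ext_act E c).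
Proof.
move=> [z zE]; rewrite (omegaE _ zE).
apply: (iff_trans (B := H2_class (Z2_act z c) = H2_class z)).
  by split=> [/eqP|->]; rewrite ?subr_eq0 ?subrr // => /eqP.
rewrite -coc_equiv.
have zcE : ext_equiv (cocycle_ext (Z2_act z c)) (ext_act E c).
  exact: ext_equiv_trans (ext_equiv_sym (ext_act_cocycle z c)) (ext_act_equiv c zE).
split=> h.
  exact: ext_equiv_trans (ext_equiv_sym zE) (ext_equiv_trans (ext_equiv_sym h) zcE).
exact: ext_equiv_trans zcE (ext_equiv_trans (ext_equiv_sym h) (ext_equiv_sym zE)).
Qed.

(** The conditions for an equivalence from [E] to its twist by [c] are exactly those of [rhoP], up
    to moving [phi] across the projection equation. *)
Lemma rho_image E (hE : Ext T (ext_class E)) c :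
  (exists g, rho hE g = c) <-> ext_equiv E (ext_act E c).
Proof.
split=> [[g /rhoP [gi gpi]]|[f [fM fi fpi]]].
  exists g; split; first exact: autb_morph.
    by move=> y; rewrite gi.
  by move=> e; rewrite /= gpi autbV autbK.
(* The twisted extension has the same underlying brace as [E], so [f] is a self-map of [E]; only the
   projection must be read differently. *)
have fpi' e : @ext_pi _ _ E (f e) = (c_pair c).1 (ext_pi e).
  by rewrite -[in RHS]fpi /= autbV autbVK.
have [g fK gK] := @ext_morph_bij _ _ E E f _ _ fM fi fpi'.
have st : is_stable (MkAutb (fM : @brace_morphism E E f) fK gK).
  apply/is_stableP => e; rewrite /= fpi'.
  split=> [|->]; last exact: autb0.
  by rewrite -[RHS](autb0 (c_pair c).1) => /(can_inj (autbK _)).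
by exists (MkAutbI st); apply/rhoP.
Qed.

End ClassActions.

Theorem theoremB (H : skewBraceType) (I : trivialBraceType)
    (T : goodTriplet H I) (E : extension H I) (hE : Ext T (ext_class E)) :
  exists j : Z1 T -> AutbI E,
    injective j /\
    {morph j : th1 th2 / th1 + th2 >-> (th1 * th2)%g} /\
    {morph rho hE : g1 g2 / (g1 * g2)%g >-> (g1 * g2)%g} /\
    (forall g : AutbI E, (exists th : Z1 T, j th = g) <-> rho hE g = 1%g) /\
    (forall (c : Cgroup T) (k : H2 T),
      Ext_actC (ext_class E) c = Ext_actH2 (ext_class E) k <->
      k = omega E c) /\
    (forall c : Cgroup T,
      (exists g : AutbI E, rho hE g = c) <-> omega E c = 0) /\
    (forall c1 c2 : Cgroup T,
      omega E (c1 * c2)%g = H2_act (omega E c1) c2 + omega E c2).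
Proof.
have Ez := ext_equiv_cocycle (Ext_has_triplet hE).
exists (derivation_autbI hE).
split; first exact: derivation_autbI_inj.
split; first exact: derivation_autbID.
split; first exact: rhoM.
split; first exact: ker_rho.
split.
  (* Existence and uniqueness of [k] together: the value of [omega] never comes from its default. *)
  by move=> c k; have [z zE] := Ez; rewrite (omegaE _ zE); exact: Ext_act_eq.
split=> [c|c1 c2]; last exact: omega_derivation.
by rewrite omega_eq0 // rho_image.
Qed.
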